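(* Let $(\Sigma,d_\Sigma)$ and $(X,d_X)$ be compact metric spaces of diameter $1$. Assume that $(\Sigma,\theta)$ is Ruelle expanding, that $\varphi:\Sigma\to\mathbb{R}$ is $\alpha$-Hölder continuous for some $0<\alpha\le1$, that $\varphi$ is a normalized potential, and that $\kappa:\Sigma\to\mathrm{Hom}(X)$ is a map such that $T(\xi,x)=(\theta(\xi),\kappa(\xi)(x))$ is continuous and that $(\Sigma,\theta,\varphi,X,\kappa)$ is backward contracting in average and always has a contracting inverse branch. Then there exists $\tau<1$ such that for any $x,y\in X$ there exists $N:\Sigma^\dagger\to\mathbb{N}$ such that for $\nu^\dagger$-almost every $(\xi_k)_{k\le0}\in\Sigma^\dagger$, $$d_X\bigl(\kappa_n(\xi_{-n})^{-1}(x),\kappa_n(\xi_{-n})^{-1}(y)\bigr)\le\tau^n d_X(x,y)\quad\text{for all }n>N((\xi_k)).$$ In particular, the inverse $S$ of the natural extension of $(\Sigma\times X,T,\mu)$ is synchronizing: for any $x,y\in X$ and $\nu^\dagger$-almost every $(\xi_k)$, the distance between $S^n((\xi_k),x)$ and $S^n((\xi_k),y)$ tends to $0$ as $n\to\infty$.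
   Context: Ruelle expanding: a continuous map $\theta$ is $(a,\rho)$-Ruelle expanding ($a>0$, $\rho\in(0,1)$) if for all $\xi,\eta,\tilde\xi\in\Sigma$ with $d_\Sigma(\xi,\eta)<a$ and $\theta(\tilde\xi)=\xi$ there is a unique $\tilde\eta\in\Sigma$ with $\theta(\tilde\eta)=\eta$ and $d_\Sigma(\tilde\xi,\tilde\eta)\le\rho\,d_\Sigma(\xi,\eta)$. For $d_\Sigma(\xi_1,\xi_2)<a$, write $\theta^n((\xi_i^\ast))=(\xi_i)$ if $\theta^n(\xi_i^\ast)=\xi_i$ for $i=1,2$ and $d_\Sigma(\xi_1^\ast,\xi_2^\ast)\le\rho^n d_\Sigma(\xi_1,\xi_2)$ (so $\xi_2^\ast$ is determined by $\xi_1^\ast$ and $\xi_2$). $\mathrm{Hom}(X)$ is the set of homeomorphisms of $X$. $\varphi$ is normalized if $\sum_{\theta\tilde\xi=\xi}e^{\varphi(\tilde\xi)}=1$ for all $\xi\in\Sigma$. Put $\kappa_n(\xi)=\kappa(\theta^{n-1}\xi)\circ\cdots\circ\kappa(\xi)$ and $\varphi_n=\sum_{k=0}^{n-1}\varphi\circ\theta^k$. Backward contracting in average means that both of the following hold ($a$ the constant of Ruelle expansion). (cp) There is $m_0$ such that for all $\xi,\eta\in\Sigma$, $x,y\in X$ there are $\xi^\ast,\eta^\ast$ with $\theta^{m_0}(\xi^\ast)=\xi$, $\theta^{m_0}(\eta^\ast)=\eta$, $d_\Sigma(\xi^\ast,\eta^\ast)<a$ and $d_X(\kappa_{m_0}(\xi^\ast)^{-1}(x),\kappa_{m_0}(\eta^\ast)^{-1}(y))<a$.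 (lebca) There are $n_0\in\mathbb{N}$ and $\rho^\ast<1$ such that for all $(\xi_1,x_1)\ne(\xi_2,x_2)$ with $d_\Sigma(\xi_1,\xi_2)<a$ and $d_X(x_1,x_2)<a$, $$\sum_{\theta^{n_0}((\xi_i^\ast))=(\xi_i)}e^{\varphi_{n_0}(\xi_1^\ast)}\Bigl(d_\Sigma(\xi_1^\ast,\xi_2^\ast)^\alpha+d_X\bigl(\kappa_{n_0}(\xi_1^\ast)^{-1}(x_1),\kappa_{n_0}(\xi_2^\ast)^{-1}(x_2)\bigr)^\alpha\Bigr)<\rho^\ast\bigl(d_\Sigma(\xi_1,\xi_2)^\alpha+d_X(x_1,x_2)^\alpha\bigr).$$ Always has a contracting inverse branch: there exists $m_0$ such that for all $\xi\in\Sigma$ and $x,y\in X$ there is $\xi^\ast\in\Sigma$ with $\theta^{m_0}(\xi^\ast)=\xi$ and $d_X(\kappa_{m_0}(\xi^\ast)^{-1}(x),\kappa_{m_0}(\xi^\ast)^{-1}(y))<a$. $\nu$ is the unique equilibrium state of $\varphi$ on $\Sigma$, i.e. the unique Borel probability measure with $\int\sum_{\theta\eta=\xi}e^{\varphi(\eta)}f(\eta)\,d\nu(\xi)=\int f\,d\nu$ for continuous $f$; it is $\theta$-invariant. $\mu$ is the unique Borel probability measure on $\Sigma\times X$ with $\int\sum_{T(\eta,y)=(\xi,x)}e^{\varphi(\eta)}f(\eta,y)\,d\mu(\xi,x)=\int f\,d\mu$ for continuous $f$. Natural extension: $\Sigma^\dagger=\{(\xi_n)_{n\le0}\in\Sigma^{\{\ldots,-1,0\}}:\theta(\xi_n)=\xi_{n+1}\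 \forall n<0\}$, $\theta^\dagger(\ldots,\xi_{-1},\xi_0)=(\ldots,\xi_{-1},\xi_0,\theta(\xi_0))$, and $\nu^\dagger$ is the unique $\theta^\dagger$-invariant probability measure projecting to $\nu$ under $(\xi_n)\mapsto\xi_0$. The natural extension of $T$ is realized on $\Sigma^\dagger\times X$ by $T^\dagger((\xi_n),x)=(\theta^\dagger((\xi_n)),\kappa(\xi_0)(x))$, with inverse $S((\xi_n)_{n\le0},x)=((\xi_n)_{n\le-1},\kappa(\xi_{-1})^{-1}(x))$. *)

(* Defs.v *)
From HB Require Import structures.
From mathcomp Require Import all_boot all_order all_algebra.
From mathcomp Require Import all_classical all_reals all_analysis.

Set Implicit Arguments.
Unset Strict Implicit.
Unset Printing Implicit Defensive.

Import Order.TTheory GRing.Theory Num.Theory.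
Import numFieldTopology.Exports.

Local Open Scope classical_set_scope.
Local Open Scope ring_scope.

(* The library's measurable types are pointed, so a metric space carrying Borel
   measures has to be pointed too; the base point plays no other role. *)
#[short(type="pmetricType")]
HB.structure Definition PointedMetric (K : numDomainType) :=
  {M of Metric K M & isPointed M}.

(* Join of existing instances, which the library leaves out. *)
HB.instance Definition _ (A B : ptopologicalType) := Pointed.on (A * B)%type.

Notation borel T := (g_sigma_algebraType (@open T)).

(* On an unbounded space [sup] takes the value 0, so [diameter M = 1] entails
   that M is bounded. *)
Definition diameter (R : realType) (M : metricType R) : R :=
  sup [set mdist p.1 p.2 | p in [set: M * M]].

Definition hoelder_continuous (R : realType) (M : metricType R) (alpha : R) (f : M -> R) :=
  exists C : R, forall x y, `|f x - f y| <= C * mdist x y `^ alpha.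

(* Hom(X); the inverse is kept as data. *)
Record homeo (X : topologicalType) := Homeo {
  homeo_fun :> X -> X ;
  homeo_inv : X -> X ;
  homeo_funK : cancel homeo_fun homeo_inv ;
  homeo_invK : cancel homeo_inv homeo_fun ;
  homeo_fun_continuous : continuous homeo_fun ;
  homeo_inv_continuous : continuous homeo_inv }.

Definition homeo_id (X : topologicalType) : homeo X :=
  @Homeo X id id (fun=> erefl) (fun=> erefl) (fun=> cvg_id) (fun=> cvg_id).

Lemma continuous_compT (X : topologicalType) (f g : X -> X) :
  continuous f -> continuous g -> continuous (f \o g).
Proof. by move=> cf cg x; apply: continuous_comp; [exact: cg|exact: cf]. Qed.

Definition homeo_comp (X : topologicalType) (g f : homeo X) : homeo X :=
  Homeo (can_comp (homeo_funK g) (homeo_funK f))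
    (can_comp (homeo_invK f) (homeo_invK g))
    (continuous_compT (@homeo_fun_continuous _ g) (@homeo_fun_continuous _ f))
    (continuous_compT (@homeo_inv_continuous _ f) (@homeo_inv_continuous _ g)).

Definition ruelle_expanding (R : realType) (Sigma : metricType R) (a rho : R)
    (theta : Sigma -> Sigma) :=
  [/\ continuous theta, 0 < a, 0 < rho < 1 &
    forall xi eta xi', mdist xi eta < a -> theta xi' = xi ->
      exists! eta', theta eta' = eta /\ mdist xi' eta' <= rho * mdist xi eta].

(* A finitely supported sum over an infinite set of nonzero terms is 0 by
   convention.  Since exp is positive, [normalized] therefore forces all fibres
   of theta to be finite and nonempty, so that every other sum over preimages
   below is an ordinary finite sum. *)
Definition normalized (R : realType) (Sigma : choiceType)
    (theta : Sigma -> Sigma) (phi : Sigma -> R) :=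
  forall xi, \sum_(xi' \in theta @^-1` [set xi]) expR (phi xi') = 1.

Definition transfer_fixed (R : realType) (Y : ptopologicalType) (F : Y -> Y)
    (psi : Y -> R) (m : probability (borel Y) R) :=
  forall f : Y -> R, continuous f ->
    \int[m]_y (\sum_(z \in F @^-1` [set y]) expR (psi z) * f z) =
    \int[m]_y f y.

Definition birkhoff_sum (R : realType) (Sigma : Type) (theta : Sigma -> Sigma)
    (phi : Sigma -> R) (n : nat) (xi : Sigma) : R :=
  \sum_(k < n) phi (iter k theta xi).

Section skew_product_system.
Context (R : realType) (Sigma X : metricType R).
Variables (a rho alpha : R) (theta : Sigma -> Sigma) (phi : Sigma -> R)
  (kappa : Sigma -> homeo X).

Definition skew_product (p : Sigma * X) : Sigma * X := (theta p.1, kappa p.1 p.2).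

Fixpoint kappa_iter (n : nat) (xi : Sigma) : homeo X :=
  if n is m.+1 then homeo_comp (kappa (iter m theta xi)) (kappa_iter m xi)
  else homeo_id X.

Definition kappa_pull (n : nat) (xi : Sigma) : X -> X :=
  homeo_inv (kappa_iter n xi).

Definition paired_preimages (n : nat) (xi1 xi2 : Sigma) : set (Sigma * Sigma) :=
  [set p | [/\ iter n theta p.1 = xi1, iter n theta p.2 = xi2 &
             mdist p.1 p.2 <= rho ^+ n * mdist xi1 xi2]].

Definition contracting_pairs :=
  exists m0 : nat, forall (xi eta : Sigma) (x y : X), exists xi' eta' : Sigma,
    [/\ iter m0 theta xi' = xi, iter m0 theta eta' = eta,
      mdist xi' eta' < a &
      mdist (kappa_pull m0 xi' x) (kappa_pull m0 eta' y) < a].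

Definition locally_contracting_in_average :=
  exists (n0 : nat) (rhos : R), rhos < 1 /\
    forall (xi1 xi2 : Sigma) (x1 x2 : X), (xi1, x1) <> (xi2, x2) ->
      mdist xi1 xi2 < a -> mdist x1 x2 < a ->
      \sum_(p \in paired_preimages n0 xi1 xi2)
        expR (birkhoff_sum theta phi n0 p.1) *
          (mdist p.1 p.2 `^ alpha +
           mdist (kappa_pull n0 p.1 x1) (kappa_pull n0 p.2 x2) `^ alpha)
      < rhos * (mdist xi1 xi2 `^ alpha + mdist x1 x2 `^ alpha).

Definition backward_contracting_in_average :=
  contracting_pairs /\ locally_contracting_in_average.

Definition always_contracting_inverse_branch :=
  exists m0 : nat, forall (xi : Sigma) (x y : X), exists xi' : Sigma,
    iter m0 theta xi' = xi /\
    mdist (kappa_pull m0 xi' x) (kappa_pull m0 xi' y) < a.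

End skew_product_system.

Section natural_extension.
Context (R : realType) (Sigma : pmetricType R).
Variable theta : Sigma -> Sigma.

(* The history (xi_k), k <= 0, is encoded as s : nat -> Sigma, s n = xi_{-n}. *)
Definition histories : set (prod_topology (fun _ : nat => Sigma)) :=
  [set s | forall n, theta (s n.+1) = s n].

Hypothesis surj : forall xi, exists xi', theta xi' = xi.

Lemma histories_nonempty : exists s, histories s.
Proof.
have [g gK] := choice surj.
by exists (fun n => iter n g point) => n /=; rewrite gK.
Qed.

Definition some_history : set_type histories :=
  exist _ (sval (cid histories_nonempty))
    (mem_set (svalP (cid histories_nonempty))).

(* Surjectivity of theta enters only to provide a base point. *)
Definition natext of (forall xi, exists xi', theta xi' = xi) : Type :=
  set_type histories.

HB.instance Definition _ := Topological.copy (natext surj) (set_type histories).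
HB.instance Definition _ := isPointed.Build (natext surj) some_history.

Definition hist (s : natext surj) (n : nat) : Sigma := set_val s n.

Lemma histE (s : natext surj) n : theta (hist s n.+1) = hist s n.
Proof. by case: s => s /= sP; exact: (set_mem sP). Qed.

Lemma hist_inj (s t : natext surj) : hist s =1 hist t -> s = t.
Proof. by move=> st; apply: val_inj; apply/funext. Qed.

Definition mk_natext (s : nat -> Sigma)
  (sP : forall n, theta (s n.+1) = s n) : natext surj := exist _ s (mem_set sP).

Definition natext_push_seq (s : natext surj) (n : nat) : Sigma :=
  if n is m.+1 then hist s m else theta (hist s 0).

Lemma natext_push_subproof (s : natext surj) n :
  theta (natext_push_seq s n.+1) = natext_push_seq s n.
Proof. by case: n => //= n; exact: histE. Qed.

(* theta^dagger *)
Definition natext_push (s : natext surj) : natext surj :=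
  mk_natext (natext_push_subproof s).

Definition natext_pull (s : natext surj) : natext surj :=
  @mk_natext (fun n => hist s n.+1) (fun n => histE s n.+1).

Lemma natext_pushK : cancel natext_push natext_pull.
Proof. by move=> s; apply: hist_inj => n. Qed.

Lemma natext_pullK : cancel natext_pull natext_push.
Proof. by move=> s; apply: hist_inj => -[|n] //; exact: (histE s 0). Qed.

(* nu^dagger: the theta^dagger-invariant lift of nu *)
Definition natext_lift (nu : probability (borel Sigma) R)
    (nud : probability (borel (natext surj)) R) :=
  (forall A : set (borel (natext surj)), measurable A ->
     nud (natext_push @^-1` A) = nud A) /\
  (forall A : set (borel Sigma), measurable A ->
     nud ((fun s => hist s 0) @^-1` A) = nu A).

Context (X : metricType R).
Variable kappa : Sigma -> homeo X.

Definition skew_natext (p : natext surj * X) : natext surj * X :=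
  (natext_push p.1, kappa (hist p.1 0) p.2).

Definition skew_natext_inv (p : natext surj * X) : natext surj * X :=
  (natext_pull p.1, homeo_inv (kappa (hist p.1 1)) p.2).

Lemma skew_natextK : cancel skew_natext skew_natext_inv.
Proof.
by case=> s x; rewrite /skew_natext_inv /= natext_pushK [hist _ 1]/= homeo_funK.
Qed.

Lemma skew_natext_invK : cancel skew_natext_inv skew_natext.
Proof.
by case=> s x; rewrite /skew_natext /= natext_pullK [hist _ 0]/= homeo_invK.
Qed.

(* A standard metric for the product topology on Sigma^dagger x X; the series
   converges when Sigma is bounded. *)
Definition natext_dist (s t : natext surj) : R :=
  limn (series (fun k => 2^-1 ^+ k.+1 * mdist (hist s k) (hist t k))).

Definition skew_natext_dist (p q : natext surj * X) : R :=
  natext_dist p.1 q.1 + mdist p.2 q.2.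

End natural_extension.

Lemma normalized_surj (R : realType) (Sigma : choiceType)
    (theta : Sigma -> Sigma) (phi : Sigma -> R) :
  normalized theta phi -> forall xi, exists xi', theta xi' = xi.
Proof.
move=> nphi xi; apply: contrapT => /forallNP noxi.
have /eqP := nphi xi; rewrite (_ : _ @^-1` _ = set0).
  by rewrite fsbig_set0 eq_sym oner_eq0.
by apply/seteqP; split => // xi' /noxi.
Qed.

(* Main.v *)
Require Import Defs.
From HB Require Import structures.
From mathcomp Require Import all_boot all_order all_algebra.
From mathcomp Require Import all_classical all_reals all_analysis.
From mathcomp Require Import measurable_realfun.

Import Order.TTheory GRing.Theory Num.Theory.
Import numFieldTopology.Exports.

Local Open Scope classical_set_scope.
Local Open Scope ring_scope.

Set Implicit Arguments.
Unset Strict Implicit.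
Unset Printing Implicit Defensive.

(** Fix two points x, y of X and let D_n(eta) be the distance between their
    pullbacks by the n-step cocycle at eta.  Along a history s the n-th
    coordinate is distributed according to nu, by invariance of its lift
    ([natext_lift_hist]), so D_n(s_n) has the law of D_n under nu.  As nu is
    fixed by the transfer operator, the mean of D_n^alpha is the nu-mean of
    the iterated transfer operator applied to D_n^alpha, and this is a sum
    over inverse branches of length n, to which the contraction in average
    applies, with equal base points.

    The contraction in average holds for points at distance less than a only,
    and after a few steps a pair may have left that range.  This is repaired by
    capping the distance: let V = min(d^alpha, a^alpha).  The mean of V after
    n0 steps is at most r V for pairs in range, and never more than V, because
    V is already maximal for pairs out of range.  From a pair out of range, some
    inverse branch leads back in range; it carries a weight bounded below,
    because phi is bounded below, and along it V then drops by a definite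
    proportion in n0 more steps.  So for one length K the mean of V after K
    steps is at most s V for all pairs, with s < 1 ([mean_dist_contraction]),
    and it decays exponentially in the number of steps, uniformly
    ([mean_dist_exponential]).

    By the Markov inequality the events V_n >= t^n then have exponentially
    small probability ([fibre_dist_tail]), where V_n is the value of V at the
    two pullbacks.  By Borel-Cantelli almost every history meets finitely many
    of them.  Once t^n is below the cap a^alpha, the inequality V_n < t^n bounds
    D_n itself by t^(n/alpha) ([fibre_dist_ae]).

    The measure nu is known to be fixed on continuous functions only.
    Two continuity statements are therefore needed: the transfer operator
    preserves continuity, because inverse branches of an expanding map move
    continuously with the base point ([transfer1_continuous]), and the pullback
    depends continuously on the base point, because the inverse of a continuous
    bijection of a compact Hausdorff space is continuous
    ([inverse_branch_continuous]). *)

(** * The iterated transfer operator *)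

Lemma ler_fsum (R : numDomainType) (I : choiceType) (P : set I) (f g : I -> R) :
  finite_set P -> (forall i, P i -> f i <= g i) ->
  \sum_(i \in P) f i <= \sum_(i \in P) g i.
Proof.
move=> finP fg; rewrite !fsbig_finite// big_seq [leRHS]big_seq.
apply: ler_sum => i.
by rewrite in_fset_set// inE => /fg.
Qed.

Section transfer.
Context (R : realType) (Sigma : choiceType).
Variables (theta : Sigma -> Sigma) (phi : Sigma -> R).

Lemma birkhoff_sumD m n xi : birkhoff_sum theta phi (n + m) xi =
  birkhoff_sum theta phi m xi + birkhoff_sum theta phi n (iter m theta xi).
Proof.
rewrite /birkhoff_sum addnC big_split_ord/=; congr (_ + _).
by apply: eq_bigr => i _; rewrite addnC iterD.
Qed.

Definition transfer n (f : Sigma -> R) (xi : Sigma) : R :=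
  \sum_(eta \in iter n theta @^-1` [set xi])
    expR (birkhoff_sum theta phi n eta) * f eta.

Lemma transfer1E f xi : transfer 1 f xi =
  \sum_(eta \in theta @^-1` [set xi]) expR (phi eta) * f eta.
Proof. by apply: eq_fsbigr => eta _; rewrite /birkhoff_sum big_ord1. Qed.

Lemma transfer0 f xi : transfer 0 f xi = f xi.
Proof.
rewrite /transfer (_ : _ @^-1` _ = [set xi]); last by [].
by rewrite fsbig_set1 /birkhoff_sum big_ord0 expR0 mul1r.
Qed.

Lemma transferZ n c f xi :
  transfer n (fun eta => c * f eta) xi = c * transfer n f xi.
Proof.
by rewrite /transfer mulr_fsumr; apply: eq_fsbigr => eta _; rewrite mulrCA.
Qed.

Lemma eq_transfer n f g xi :
  (forall eta, iter n theta eta = xi -> f eta = g eta) ->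
  transfer n f xi = transfer n g xi.
Proof. by move=> fg; apply: eq_fsbigr => eta; rewrite inE => /fg ->. Qed.

Hypothesis normalized_phi : normalized theta phi.

(** A sum with infinitely many nonzero terms has the value 0 by convention, and
    the exponential does not vanish: normalization rules out infinite fibres. *)
Lemma finite_fibre xi : finite_set (theta @^-1` [set xi]).
Proof.
apply: contrapT => infin; have /eqP := normalized_phi xi.
rewrite fsbig_dflt ?[0 == 1]eq_sym ?oner_eq0//; apply: contra_not infin.
apply: sub_finite_set => eta /= theta_eta; split => //.
by apply/eqP; rewrite gt_eqF ?expR_gt0.
Qed.

Lemma finite_fibre_iter n xi : finite_set (iter n theta @^-1` [set xi]).
Proof.
elim: n xi => [|n IHn] xi; first exact: finite_set1.
rewrite (_ : _ @^-1` _ =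
    \bigcup_(zeta in theta @^-1` [set xi]) (iter n theta @^-1` [set zeta])).
  by apply: bigcup_finite => //; exact: finite_fibre.
apply/seteqP; split=> [eta /= <-|eta [zeta /= <- <-//]].
by exists (iter n theta eta).
Qed.

(** Each branch of length n + m splits uniquely at its intermediate point.  The
    fibre sums over varying base points are made comparable by writing both as
    sums over the finite fibre of length n + m. *)
Lemma transferD m n f xi :
  transfer (n + m) f xi = transfer n (transfer m f) xi.
Proof.
rewrite /transfer; set U := iter (n + m) theta @^-1` _.
set Z := iter n theta @^-1` _.
have finU : finite_set U by exact: finite_fibre_iter.
have finZ : finite_set Z by exact: finite_fibre_iter.
pose g zeta eta := if iter m theta eta == zeta
  then expR (birkhoff_sum theta phi n zeta) *
       (expR (birkhoff_sum theta phi m eta) * f eta) else 0.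
transitivity (\sum_(eta \in U) \sum_(zeta \in Z) g zeta eta).
  apply: eq_fsbigr => eta; rewrite inE/= => etaU.
  have Zeta : Z (iter m theta eta) by rewrite /Z/= -iterD.
  rewrite (fsbigD1 (iter m theta eta))// fsbig1 /= ?addr0 => [|zeta [_ /eqP]].
    by rewrite /g eqxx birkhoff_sumD expRD [RHS]mulrCA mulrA.
  by rewrite /g eq_sym => /negbTE ->.
rewrite exchange_fsbig//; apply: eq_fsbigr => zeta; rewrite inE/= => zetaZ.
rewrite mulr_fsumr -[LHS](fsbig_widen (iter m theta @^-1` [set zeta])).
- by apply: eq_fsbigr => eta; rewrite inE/= /g => ->; rewrite eqxx.
- by move=> eta /= eta_zeta; rewrite /U/= iterD eta_zeta.
- by move=> eta /= [_ /eqP /negbTE]; rewrite /g => ->.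
Qed.

Lemma transfer_cst n c xi : transfer n (fun=> c) xi = c.
Proof.
elim: n xi => [|n IHn] xi; first exact: transfer0.
rewrite -addn1 transferD (eq_transfer (g := fun=> c)) ?IHn// => eta _.
by rewrite transfer1E -mulr_fsuml normalized_phi mul1r.
Qed.

Lemma le_transfer n f g xi :
  (forall eta, iter n theta eta = xi -> f eta <= g eta) ->
  transfer n f xi <= transfer n g xi.
Proof.
move=> fg; apply: ler_fsum => [|eta /fg ?]; first exact: finite_fibre_iter.
by rewrite ler_wpM2l// expR_ge0.
Qed.

Lemma transfer_ge0 n f xi :
  (forall eta, 0 <= f eta) -> 0 <= transfer n f xi.
Proof. by move=> f0; rewrite -[leLHS](transfer_cst n _ xi) le_transfer. Qed.

(** The weights of the branches sum to 1, so the transfer operator takes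
    averages, and one exceptional branch improves a uniform bound in proportion
    to its weight. *)
Lemma transfer_le_gap n f c d xi eta :
  (forall eta', iter n theta eta' = xi -> f eta' <= c) ->
  iter n theta eta = xi -> f eta <= c - d ->
  transfer n f xi <= c - expR (birkhoff_sum theta phi n eta) * d.
Proof.
move=> fc eta_xi feta; pose g eta' := if eta' == eta then c - d else c.
apply: (@le_trans _ _ (transfer n g xi)).
  by apply: le_transfer => eta' /fc; rewrite /g; case: eqP => // ->.
suff -> : transfer n g xi = transfer n (fun=> c) xi -
    expR (birkhoff_sum theta phi n eta) * d by rewrite transfer_cst.
rewrite /transfer !(fsbigD1 eta _ _ (finite_fibre_iter n xi))// {1}/g eqxx /=.
rewrite mulrBr addrAC; congr (_ + _ - _).
by apply: eq_fsbigr => eta'; rewrite inE /g => -[_ /eqP/negbTE ->].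
Qed.

End transfer.

(** * The averaged capped distance *)

Section pull.
Context (R : realType) (Sigma X : metricType R).
Variables (theta : Sigma -> Sigma) (kappa : Sigma -> homeo X).
Local Notation pull := (kappa_pull theta kappa).

Lemma kappa_pullS n eta x :
  pull n.+1 eta x = pull n eta (homeo_inv (kappa (iter n theta eta)) x).
Proof. by []. Qed.

Lemma kappa_pullD m n eta x :
  pull (n + m) eta x = pull m eta (pull n (iter m theta eta) x).
Proof.
elim: n x => [//|n IHn] x.
by rewrite addSn !kappa_pullS IHn iterD.
Qed.

Lemma kappa_pull_inj n eta : injective (pull n eta).
Proof. exact: can_inj (homeo_invK _). Qed.

End pull.

Section capped_distance.
Context (R : realType) (X : metricType R).
Variables (a alpha : R).

(** The cap a^alpha makes every pair out of the range of the contraction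
    hypothesis have the same, maximal value. *)
Definition capped_dist (x y : X) : R :=
  Num.min (mdist x y `^ alpha) (a `^ alpha).

Lemma capped_dist_ge0 x y : 0 <= capped_dist x y.
Proof. by rewrite le_min !powR_ge0. Qed.

Lemma capped_dist_le x y : capped_dist x y <= a `^ alpha.
Proof. by rewrite ge_min lexx orbT. Qed.

Hypotheses (a0 : 0 < a) (alpha0 : 0 < alpha).

Lemma capped_dist_near x y : mdist x y < a ->
  capped_dist x y = mdist x y `^ alpha.
Proof.
move=> xya; rewrite /capped_dist min_l// ge0_ler_powR// ?nnegrE ?mdist_ge0//.
- exact: ltW.
- exact: ltW.
- exact: ltW.
Qed.

Lemma capped_dist_far x y : a <= mdist x y -> capped_dist x y = a `^ alpha.
Proof.
move=> xya; rewrite /capped_dist min_r// ge0_ler_powR// ?nnegrE ?mdist_ge0//.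
- exact: ltW.
- exact: ltW.
Qed.

Lemma capped_distxx x : capped_dist x x = 0.
Proof. by rewrite capped_dist_near mdistxx// powR0// gt_eqF. Qed.

End capped_distance.

Section contraction.
Context (R : realType) (Sigma X : metricType R).
Variables (a rho alpha : R) (theta : Sigma -> Sigma) (phi : Sigma -> R)
  (kappa : Sigma -> homeo X).
Hypotheses (a0 : 0 < a) (alpha0 : 0 < alpha)
  (normalized_phi : normalized theta phi).
Local Notation pull := (kappa_pull theta kappa).
Local Notation V := (capped_dist a alpha).

(** The expectation of the capped distance after n random backward steps from
    the base point [xi], where each step chooses a preimage with weight
    exp phi. *)
Definition mean_dist n (xi : Sigma) (x y : X) : R :=
  transfer theta phi n (fun eta => V (pull n eta x) (pull n eta y)) xi.

(** The Markov property of the random backward walk on pairs of points. *)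
Lemma mean_distD n m xi x y : mean_dist (n + m) xi x y =
  transfer theta phi n
    (fun zeta => mean_dist m zeta (pull n zeta x) (pull n zeta y)) xi.
Proof.
rewrite /mean_dist transferD//; apply: eq_transfer => zeta _.
by apply: eq_transfer => eta eta_zeta; rewrite !kappa_pullD eta_zeta.
Qed.

Lemma mean_dist_le_cap n xi x y : mean_dist n xi x y <= a `^ alpha.
Proof.
rewrite -[leRHS](transfer_cst normalized_phi n _ xi); apply: le_transfer => //.
by move=> eta _; exact: capped_dist_le.
Qed.

Lemma mean_distxx n xi x : mean_dist n xi x x = 0.
Proof.
rewrite -[RHS](transfer_cst normalized_phi n _ xi); apply: eq_transfer => eta _.
by rewrite capped_distxx.
Qed.

Lemma mean_distDM n m c xi x y :
  (forall zeta x y, mean_dist m zeta x y <= c * V x y) ->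
  mean_dist (n + m) xi x y <= c * mean_dist n xi x y.
Proof.
by move=> mc; rewrite mean_distD -transferZ; apply: le_transfer.
Qed.

Lemma iterated_mean_dist K c j xi x y : 0 <= c ->
  (forall zeta x y, mean_dist K zeta x y <= c * V x y) ->
  mean_dist (j * K) xi x y <= c ^+ j * V x y.
Proof.
move=> c0 Kc; elim: j xi x y => [|j IHj] xi x y.
  by rewrite mul0n expr0 mul1r /mean_dist transfer0.
rewrite mulSn (le_trans (mean_distDM _ _ _ _ IHj))// exprSr -mulrA.
by rewrite ler_wpM2l// exprn_ge0.
Qed.

(** With equal base points the pairing condition forces equal preimages, so the
    sum over pairs is a sum over the fibre, and the base distances drop out. *)
Lemma diagonal_contraction :
  locally_contracting_in_average a rho alpha theta phi kappa ->
  exists n0 r, 0 < r < 1 /\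
    forall xi x y, mdist x y < a -> mean_dist n0 xi x y <= r * V x y.
Proof.
(* rhos may be negative; the maximum with 1/2 gives a factor in (0, 1). *)
case=> n0 [rhos [rhos1 contr]]; exists n0, (Num.max rhos 2^-1); split.
  rewrite lt_max invr_gt0 ltr0n orbT/= gt_max rhos1/=.
  by rewrite invf_lt1 ?ltr1n.
move=> xi x y xya; have [<-|xy] := eqVneq x y.
  by rewrite capped_distxx// mulr0 mean_distxx.
have xixy : (xi, x) <> (xi, y) by case=> /eqP; exact/negP.
apply: (@le_trans _ _ (rhos * V x y)); last first.
  by rewrite ler_wpM2r ?capped_dist_ge0// le_max lexx.
have := contr xi xi x y xixy; rewrite mdistxx => /(_ a0 xya).
rewrite powR0 ?gt_eqF// add0r -(capped_dist_near a0)// => /ltW; apply: le_trans.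
rewrite (_ : paired_preimages _ _ _ _ _ =
    (fun eta => (eta, eta)) @` (iter n0 theta @^-1` [set xi])).
  rewrite fsbig_image; last by move=> ? ? _ _ [].
  apply: ler_fsum => [|eta _ /=].
    exact: finite_fibre_iter normalized_phi _ _.
  by rewrite ler_wpM2l ?expR_ge0// mdistxx powR0 ?gt_eqF// add0r ge_min lexx.
apply/seteqP; split=> [[p1 p2] [/= p1xi p2xi]|_ [eta /= etaxi <-]].
  rewrite mdistxx mulr0 => p12; exists p1 => //; congr (_, _).
  by apply: mdist_positivity; apply/eqP; rewrite eq_le p12 mdist_ge0.
by split=> //=; rewrite !mdistxx mulr0.
Qed.

(** The time of a contracting branch may be increased: any m - m0 backward steps
    may precede it.  This allows it to be chosen a multiple of the contraction
    time. *)
Lemma contracting_branch_later :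
  always_contracting_inverse_branch a theta kappa ->
  exists m0, forall m, (m0 <= m)%N -> forall xi x y, exists eta,
    iter m theta eta = xi /\ mdist (pull m eta x) (pull m eta y) < a.
Proof.
have surj n xi : exists eta, iter n theta eta = xi.
  elim: n xi => [|n IHn] xi; first by exists xi.
  have [eta <-] := normalized_surj normalized_phi xi.
  by have [zeta <-] := IHn eta; exists zeta.
case=> m0 branch; exists m0 => m m0m xi x y.
have [zeta zeta_xi] := surj (m - m0)%N xi.
have [eta [eta_zeta near]] :=
  branch zeta (pull (m - m0) zeta x) (pull (m - m0) zeta y).
exists eta; rewrite -(subnK m0m) !kappa_pullD eta_zeta; split => //.
by rewrite iterD eta_zeta.
Qed.

(** A pair in range contracts in the first n0 of M + n0 steps, and the last M
    steps, a multiple of n0, do no harm.  A pair out of range has the maximal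
    value a^alpha; among its branches of length M one comes back in range, with
    weight at least [w], and shrinks by the factor r in the n0 steps after that. *)
Lemma mean_dist_contraction b : (forall xi, b <= phi xi) ->
  locally_contracting_in_average a rho alpha theta phi kappa ->
  always_contracting_inverse_branch a theta kappa ->
  exists K s, [/\ (0 < K)%N, 0 < s < 1 &
    forall xi x y, mean_dist K xi x y <= s * V x y].
Proof.
move=> phib /diagonal_contraction[n0 [r [/andP[r0 r1] near_contr]]].
move=> /contracting_branch_later[m0 branch].
(* For n0 = 0 the contraction says that points in range coincide; as any two
   points have pullbacks in range, X has at most one point. *)
have [n00|n0_gt0] := posnP n0.
  have XE (xi : Sigma) (x y : X) : x = y.
    have [eta [_ near]] := branch m0 (leqnn _) xi x y.
    have := near_contr eta _ _ near.
    rewrite n00 /mean_dist transfer0 /= capped_dist_near//.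
    rewrite -subr_le0 -{1}[_ `^ _]mul1r -mulrBl pmulr_rle0 ?subr_gt0// => V0.
    have /eqP : mdist (pull m0 eta x) (pull m0 eta y) `^ alpha == 0.
      by rewrite eq_le V0 powR_ge0.
    by move/powR_eq0_eq0/mdist_positivity/kappa_pull_inj.
  exists 1%N, 2^-1; split=> // [|xi x y].
    by rewrite invr_gt0 ltr0n invf_lt1 ?ltr1n.
  by rewrite (XE xi x y) capped_distxx// mulr0 mean_distxx.
have V_n0 xi x y : mean_dist n0 xi x y <= 1 * V x y.
  rewrite mul1r; have [xya|xya] := ltP (mdist x y) a.
    rewrite (le_trans (near_contr xi _ _ xya))// ler_piMl ?capped_dist_ge0//.
    exact: ltW.
  by rewrite (capped_dist_far a0)// mean_dist_le_cap.
pose M := (m0 * n0)%N.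
have m0M : (m0 <= M)%N by rewrite leq_pmulr.
have V_M xi x y : mean_dist M xi x y <= 1 * V x y.
  by rewrite -(expr1n _ m0); exact: iterated_mean_dist.
pose w := expR (b *+ M).
have w_le xi : w <= expR (birkhoff_sum theta phi M xi).
  rewrite ler_expR /birkhoff_sum -[leLHS]mulr_natl -[M in M%:R]card_ord.
  by rewrite mulr_natl -sumr_const; apply: ler_sum => i _.
exists (M + n0)%N, (Num.max r (1 - w * (1 - r))); split.
- by rewrite addn_gt0 n0_gt0 orbT.
- rewrite lt_max r0/= gt_max r1/= ltrBlDr ltrDl mulr_gt0 ?expR_gt0//.
  by rewrite subr_gt0.
move=> xi x y; have [xya|xya] := ltP (mdist x y) a.
  rewrite addnC (le_trans (mean_distDM _ _ _ _ V_M))// mul1r.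
  rewrite (le_trans (near_contr _ _ _ xya))// ler_wpM2r ?capped_dist_ge0//.
  by rewrite le_max lexx.
rewrite mean_distD (capped_dist_far a0)//.
have [eta [eta_xi near]] := branch M m0M xi x y.
apply: le_trans (transfer_le_gap (c := a `^ alpha) (d := (1 - r) * a `^ alpha)
  normalized_phi _ eta_xi _) _ => [zeta _||].
- exact: mean_dist_le_cap.
- rewrite (le_trans (near_contr _ _ _ near))//.
  rewrite mulrBl mul1r opprB addrCA subrr addr0.
  by rewrite ler_wpM2l ?capped_dist_le// ltW.
rewrite mulrA -{1}[a `^ alpha]mul1r -mulrBl ler_wpM2r ?powR_ge0//.
rewrite le_max; apply/orP; right; rewrite lerD2l lerN2 ler_wpM2r//.
by rewrite subr_ge0 ltW.
Qed.

Lemma mean_dist_exponential b : (forall xi, b <= phi xi) ->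
  locally_contracting_in_average a rho alpha theta phi kappa ->
  always_contracting_inverse_branch a theta kappa ->
  exists C s, 0 < s < 1 /\ forall n xi x y, mean_dist n xi x y <= C * s ^+ n.
Proof.
move=> phib lca cib.
have [K [r [K0 /andP[r0 r1] contr]]] := mean_dist_contraction phib lca cib.
(* s is the K-th root of r; the division of n by K leaves a remainder below K,
   which costs a factor of at most 1 / r. *)
pose s := r `^ K%:R^-1.
have s0 : 0 < s by rewrite powR_gt0.
have sK : s ^+ K = r.
  rewrite -powR_mulrn ?powR_ge0// -powRrM mulVf ?powRr1 ?pnatr_eq0 -?lt0n//.
  exact: ltW.
have s1 : s < 1 by rewrite -(@expr_lt1 _ K)// ?sK// ltW.
exists (a `^ alpha / r), s; split=> [|n xi x y]; first by rewrite s0.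
rewrite {1}(divn_eq n K) addnC.
rewrite (le_trans (mean_distDM _ _ _ _ (fun zeta x y =>
  iterated_mean_dist _ zeta x y (ltW r0) contr)))//.
rewrite [leLHS]mulrC -mulrA ler_pM ?mean_dist_le_cap//.
- by apply: transfer_ge0 => // eta; exact: capped_dist_ge0.
- by rewrite exprn_ge0// ltW.
rewrite mulrC ler_pdivlMr// -exprSr -sK -exprM ler_wiXn2l ?ltW//.
by rewrite mulnC mulSn {1}(divn_eq n K) addnC leq_add2r ltnW// ltn_pmod.
Qed.

End contraction.

(** * Continuity *)

Section real_continuity.
Import numFieldNormedType.Exports.
Context (R : realType).

(** The sign condition is what gives continuity at 0: the real power of a
    negative number is 1 by convention. *)
Lemma cvg_powR (T : Type) (F : set_system T) {FF : Filter F} (f : T -> R)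
    (l alpha : R) :
  0 < alpha -> (forall t, 0 <= f t) ->
  f t @[t --> F] --> l -> f t `^ alpha @[t --> F] --> l `^ alpha.
Proof.
move=> alpha0 f0 fl; have [l0|l0|l0] := ltgtP l 0.
- have fl0 : \forall t \near F, f t < 0 by exact: cvgr_lt fl _ l0.
  apply: cvg_near_cst; near=> t.
  by have := f0 t; rewrite leNgt; case/negP; near: t.
- have : expR (alpha * ln (f t)) @[t --> F] --> expR (alpha * ln l).
    apply: continuous_cvg; first exact: continuous_expR.
    apply: cvgMl_tmp; apply: continuous_cvg fl; exact: continuous_ln.
  rewrite {2}/powR gt_eqF//; apply: cvg_trans; apply: near_eq_cvg.
  have ft0 : \forall t \near F, 0 < f t by exact: cvgr_gt fl _ l0.
  by near=> t; rewrite /powR gt_eqF//; near: t.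
- move: fl; rewrite l0 powR0 ?gt_eqF// => fl.
  apply/cvgrPdist_lt => e e0.
  have e'0 : 0 < e `^ alpha^-1 by rewrite powR_gt0.
  have /cvgrPdist_lt/(_ _ e'0) := fl.
  apply: filterS => t; rewrite !sub0r !normrN !ger0_norm ?powR_ge0// => fte.
  have /= := gt0_ltr_powR alpha0 _ _ fte.
  rewrite -powRrM mulVf ?gt_eqF// powRr1 ?ltW//; apply.
    by rewrite nnegrE.
by rewrite nnegrE ltW.
Unshelve. all: by end_near. Qed.

Lemma mdist_continuous (M : metricType R) :
  continuous (fun p : M * M => mdist p.1 p.2 : R).
Proof.
move=> [x y]; apply/cvgrPdist_lt => /= e e0.
have e20 : 0 < e / 2 by rewrite divr_gt0.
exists (ball x (e / 2), ball y (e / 2)); first by split; exact: nbhsx_ballx.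
move=> [x' y'] /= []; rewrite !ballEmdist/= => xx' yy'.
rewrite ltr_distlC; apply/andP; split.
  rewrite ltrBlDr (le_lt_trans (metric_triangle x x' y))//.
  rewrite [ltLHS]addrC.
  rewrite (le_lt_trans (lerD (metric_triangle x' y' y) (lexx _)))//.
  by rewrite -addrA ltrD2l [e]splitr ltrD// metric_sym.
rewrite (le_lt_trans (metric_triangle x' x y'))//.
rewrite (le_lt_trans (lerD (lexx _) (metric_triangle x y y')))//.
by rewrite addrCA ltrD2l [e]splitr ltrD// metric_sym.
Qed.

Lemma hoelder_is_continuous (M : metricType R) (alpha : R) (f : M -> R) :
  0 < alpha -> hoelder_continuous alpha f -> continuous f.
Proof.
move=> alpha0 [C fC] x; apply/subr_cvg0/norm_cvg0P.
have : C * mdist y x `^ alpha @[y --> x] --> (0 : R).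
  rewrite -[X in _ --> X](mulr0 C); apply: cvgMl_tmp.
  rewrite -[X in _ --> X](_ : mdist x x `^ alpha = 0).
    apply: cvg_powR => // [y|]; first exact: mdist_ge0.
    apply: (@continuous2_cvg _ _ _ _ _ _ id (fun=> x) mdist).
    - exact: (@mdist_continuous M (x, x)).
    - exact: cvg_id.
    - exact: cvg_cst.
  by rewrite mdistxx powR0// gt_eqF.
apply: squeeze_cvgr; last exact: cvg_cst.
by apply: nearW => y; rewrite normr_ge0/= fC.
Qed.

End real_continuity.

Section transfer_continuity.
Import numFieldNormedType.Exports.

Lemma cvg_fsum (K : numFieldType) (I : choiceType) (T : Type) (F : set_system T)
    {FF : Filter F} (P : set I) (f : I -> T -> K) (l : I -> K) :
  finite_set P -> (forall i, P i -> f i t @[t --> F] --> l i) ->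
  \sum_(i \in P) f i t @[t --> F] --> \sum_(i \in P) l i.
Proof.
move=> finP fl; rewrite fsbig_finite// big_seq.
under eq_cvg do rewrite fsbig_finite// big_seq.
apply: cvg_big => [|i]; first exact: add_continuous.
by rewrite in_fset_set// inE => /fl.
Qed.

Context (R : realType) (Sigma : metricType R).
Variables (a rho : R) (theta : Sigma -> Sigma) (phi : Sigma -> R).
Hypotheses (expanding : ruelle_expanding a rho theta)
  (normalized_phi : normalized theta phi) (phi_cont : continuous phi).

(** For eta near xi, following the inverse branches gives a bijection between
    the fibres of xi and eta which moves points by at most rho d(xi, eta); so
    the transfer operator at eta is a sum over the fixed finite fibre of xi, of
    terms that converge as eta tends to xi. *)
Lemma transfer1_continuous f :
  continuous f -> continuous (transfer theta phi 1 f).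
Proof.
move=> f_cont xi; case: expanding => _ a0 /andP[rho0 _] lift.
pose g eta := expR (phi eta) * f eta.
have g_cont : continuous g.
  move=> eta; apply: cvgM; last exact: f_cont.
  by apply: continuous_cvg; [exact: continuous_expR|exact: phi_cont].
(* [L eta xi'] is the preimage of eta that shadows the preimage xi' of xi. *)
have [L LP] : {L : Sigma -> Sigma -> Sigma | forall eta xi',
    mdist xi eta < a -> theta xi' = xi ->
    theta (L eta xi') = eta /\ mdist xi' (L eta xi') <= rho * mdist xi eta}.
  suff /choice[L LP] : forall p : Sigma * Sigma, exists z, mdist xi p.1 < a ->
      theta p.2 = xi -> theta z = p.1 /\ mdist p.2 z <= rho * mdist xi p.1.
    by exists (fun eta xi' => L (eta, xi')) => eta xi'; exact: LP (eta, xi').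
  move=> [eta xi'] /=; have [[near xi'xi]|no] :=
    pselect (mdist xi eta < a /\ theta xi' = xi).
    by have [z [? _]] := lift _ _ _ near xi'xi; exists z.
  by exists xi => near xi'xi; case: no.
have uniq p q p' z z' : mdist p q < a -> theta p' = p ->
    theta z = q -> mdist p' z <= rho * mdist p q ->
    theta z' = q -> mdist p' z' <= rho * mdist p q -> z = z'.
  move=> pq p'p zq pz z'q pz'; have [y [_ yu]] := lift _ _ _ pq p'p.
  by rewrite -(yu z)// -(yu z').
(* Both injectivity and surjectivity express that shadowing is symmetric: two
   points shadow each other, and shadows are unique. *)
have L_bij eta : mdist xi eta < a ->
    set_bij (theta @^-1` [set xi]) (theta @^-1` [set eta]) (L eta).
  move=> near; have near' : mdist eta xi < a by rewrite metric_sym.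
  split=> [xi' /= xi'xi|z1 z2|z /= z_eta]; first by case: (LP eta xi').
    rewrite !inE/= => z1xi z2xi L12.
    have [L1 d1] := LP eta z1 near z1xi; have [L2 d2] := LP eta z2 near z2xi.
    apply: (uniq eta xi (L eta z1)) => //.
      by rewrite metric_sym [mdist eta xi]metric_sym.
    by rewrite metric_sym [mdist eta xi]metric_sym L12.
  have [z' [[z'xi zz'] _]] := lift _ _ _ near' z_eta.
  exists z' => //; have [Lz' dz'] := LP eta z' near z'xi.
  apply: (uniq xi eta z') => //.
  by rewrite metric_sym [mdist xi eta]metric_sym.
have near_xi : \forall eta \near xi, mdist xi eta < a.
  by have := nbhsx_ballx xi _ a0; rewrite ballEmdist.
have L_cvg xi' : theta xi' = xi -> L eta xi' @[eta --> xi] --> xi'.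
  move=> xi'xi; apply/metricType_numDomainType.cvgrPdist_lt => e e0; near=> eta.
  have near : mdist xi eta < a by near: eta.
  have [_ d] := LP eta xi' near xi'xi; apply: le_lt_trans d _.
  rewrite mulrC -ltr_pdivlMr//; near: eta.
  by have := nbhsx_ballx xi _ (divr_gt0 e0 rho0); rewrite ballEmdist.
rewrite /continuous_at transfer1E.
have sum_cvg : \sum_(xi' \in theta @^-1` [set xi]) g (L eta xi') @[eta --> xi]
    --> \sum_(xi' \in theta @^-1` [set xi]) g xi'.
  apply: cvg_fsum; first exact: finite_fibre normalized_phi xi.
  by move=> xi' /L_cvg/cvg_comp; apply; exact: g_cont.
apply: cvg_trans sum_cvg; apply: near_eq_cvg; near=> eta.
have near : mdist xi eta < a by near: eta.
by rewrite transfer1E (reindex_fsbig _ _ _ _ (L_bij _ near)).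
Unshelve. all: by end_near. Qed.

Lemma transfer_continuous n f :
  continuous f -> continuous (transfer theta phi n f).
Proof.
move=> f_cont; elim: n => [|n IHn].
  by rewrite (_ : transfer _ _ _ _ = f)//; apply/funext => xi; exact: transfer0.
rewrite (_ : transfer _ _ _ _ = transfer theta phi 1 (transfer theta phi n f)).
  exact: transfer1_continuous.
by apply/funext => xi; rewrite -add1n transferD.
Qed.

End transfer_continuity.

Lemma hausdorff_setX (A B : topologicalType) :
  hausdorff_space A -> hausdorff_space B -> hausdorff_space (A * B)%type.
Proof.
move=> hA hB [p1 p2] [q1 q2] pq; congr (_, _).
- apply: hA => U V Up Vq; have [] := pq (U `*` setT) (V `*` setT).
  + by exists (U, setT) => //; split => //; exact: filterT.
  + by exists (V, setT) => //; split => //; exact: filterT.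
  + by move=> [x y] [[Ux _] [Vx _]]; exists x.
- apply: hB => U V Up Vq; have [] := pq (setT `*` U) (setT `*` V).
  + by exists (setT, U) => //; split => //; exact: filterT.
  + by exists (setT, V) => //; split => //; exact: filterT.
  + by move=> [x y] [[_ Uy] [_ Vy]]; exists y.
Qed.

Section pull_continuity.
Context (R : realType) (Sigma X : metricType R).
Variables (theta : Sigma -> Sigma) (kappa : Sigma -> homeo X).
Hypotheses (compact_Sigma : compact [set: Sigma]) (compact_X : compact [set: X])
  (theta_cont : continuous theta)
  (T_cont : continuous (skew_product theta kappa)).

(** (xi, x) |-> (xi, kappa(xi)(x)) is a continuous bijection of a compact
    Hausdorff space, hence a closed map, so its inverse is continuous. *)
Lemma inverse_branch_continuous :
  continuous (fun p : Sigma * X => homeo_inv (kappa p.1) p.2).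
Proof.
pose G (p : Sigma * X) := (p.1, kappa p.1 p.2).
pose H (p : Sigma * X) := (p.1, homeo_inv (kappa p.1) p.2).
have GK : cancel G H by case=> xi x; rewrite /G /H /= homeo_funK.
have HK : cancel H G by case=> xi x; rewrite /G /H /= homeo_invK.
have G_cont : continuous G.
  move=> p; apply: cvg_pair; first exact: cvg_fst.
  apply: (@cvg_comp _ _ _ (skew_product theta kappa) snd); first exact: T_cont.
  exact: cvg_snd.
have H_cont : continuous H.
  apply/continuous_closedP => C C_closed.
  rewrite (_ : H @^-1` C = G @` C); last first.
    by apply/seteqP; split=> [p Cp|_ [p Cp <-]]; [exists (H p)|rewrite /= GK].
  apply: compact_closed.
    by apply: hausdorff_setX; exact: metric_hausdorff.
  apply: continuous_compact; first exact: continuous_subspaceT.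
  have cT : compact [set: Sigma * X] by rewrite -setXTT; exact: compact_setX.
  exact: subclosed_compact C_closed cT _.
by move=> p; apply: (@cvg_comp _ _ _ H snd); [exact: H_cont|exact: cvg_snd].
Qed.

Lemma kappa_pull_continuous n :
  continuous (fun p : Sigma * X => kappa_pull theta kappa n p.1 p.2).
Proof.
have iter_cont m : continuous (iter m theta).
  elim: m => [|m IHm] xi; first exact: cvg_id.
  by apply: continuous_comp; [exact: IHm|exact: theta_cont].
elim: n => [|n IHn]; first by move=> p; exact: cvg_snd.
pose step (p : Sigma * X) := (iter n theta p.1, p.2).
have step_cont : continuous step.
  move=> p; apply: cvg_pair; last exact: cvg_snd.
  by apply: cvg_comp cvg_fst _; exact: iter_cont.
pose pull1 (p : Sigma * X) := (p.1, homeo_inv (kappa (iter n theta p.1)) p.2).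
have pull1_cont : continuous pull1.
  move=> p; apply: cvg_pair; first exact: cvg_fst.
  exact: continuous_comp (step_cont p)
    (inverse_branch_continuous (x := step p)).
by move=> p; exact: continuous_comp (pull1_cont p) (IHn (pull1 p)).
Qed.

End pull_continuity.

Section capped_dist_continuity.
Import numFieldNormedType.Exports.
Context (R : realType) (Sigma X : metricType R).
Variables (a alpha : R).
Hypothesis alpha0 : 0 < alpha.

Lemma capped_dist_continuous (u v : Sigma -> X) :
  continuous u -> continuous v ->
  continuous (fun eta => capped_dist a alpha (u eta) (v eta)).
Proof.
move=> u_cont v_cont eta; apply: (@continuous_min R Sigma
  (fun eta => mdist (u eta) (v eta) `^ alpha) (fun=> a `^ alpha) eta);
  last exact: cvg_cst.
apply: cvg_powR => // [t|]; first exact: mdist_ge0.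
apply: (@continuous2_cvg _ _ _ _ _ _ u v mdist).
- exact: (@mdist_continuous R X (u eta, v eta)).
- exact: u_cont.
- exact: v_cont.
Qed.

End capped_dist_continuity.

(** * Borel measures and the transfer operator *)

Lemma open_borel (T : ptopologicalType) (A : set T) :
  open A -> measurable (A : set (borel T)).
Proof. exact: sub_sigma_algebra. Qed.

Lemma continuous_borel (T U : ptopologicalType) (f : T -> U)
    (A : set (borel U)) :
  continuous f -> measurable A -> measurable (f @^-1` A : set (borel T)).
Proof.
move=> f_cont mA.
have f_meas : measurable_fun [set: borel T] (f : borel T -> borel U).
  apply: (@measurability _ _ (borel T) (borel U) setT f open) => //.
  move=> _ [B B_open <-].
  rewrite setTI; apply: open_borel; apply: open_comp => // x _; exact: f_cont.
by have := f_meas measurableT A mA; rewrite setTI.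
Qed.

Section borel_integral.
Import numFieldNormedType.Exports.
Context (R : realType) (T : ptopologicalType).
Variable m : probability (borel T) R.

Lemma continuous_borel_measurable (f : T -> R) :
  continuous f -> measurable_fun [set: borel T] (f : borel T -> R).
Proof.
move=> f_cont.
apply: (@measurability _ _ (borel T) _ setT f (@RGenOpens.G R)) =>
  [|_ [_ [x [y ->]] <-]].
  exact: RGenOpens.measurableE.
rewrite setTI; apply: open_borel; apply: open_comp => [z _|].
  exact: f_cont.
exact: interval_open.
Qed.

Lemma measurable_superlevel (f : T -> R) e :
  continuous f -> measurable ([set x | e <= f x] : set (borel T)).
Proof.
move=> /continuous_borel_measurable f_meas.
have := f_meas measurableT _ (measurable_itv `[e, +oo[); rewrite setTI.
congr measurable; apply/seteqP.
by split=> x /=; rewrite in_itv/= andbT.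
Qed.

Lemma continuous_integrable (f : T -> R) c : continuous f ->
  (forall x, 0 <= f x <= c) -> m.-integrable [set: borel T] (EFin \o f).
Proof.
move=> f_cont fc.
apply: (@le_integrable _ _ _ m setT measurableT _ (EFin \o (fun=> c))).
- by apply/measurable_EFinP; exact: continuous_borel_measurable.
- move=> x _ /=; have /andP[f0 fc'] := fc x.
  by rewrite lee_fin !ger0_norm// (le_trans f0).
- exact: finite_measure_integrable_cst.
Qed.

Lemma continuous_Rintegral_le (f : T -> R) c : continuous f ->
  (forall x, 0 <= f x <= c) -> \int[m]_x f x <= c.
Proof.
move=> f_cont fc; have := Rintegral_cst m (@measurableT _ (borel T)) c.
rewrite [fine _](congr1 fine (probability_setT m)) mulr1 => <-.
apply: le_Rintegral => //; first exact: continuous_integrable fc.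
  exact: finite_measure_integrable_cst.
by move=> x _; case/andP: (fc x).
Qed.

Lemma continuous_markov (f : T -> R) c e : continuous f ->
  (forall x, 0 <= f x <= c) -> 0 < e ->
  (m [set x | (e <= f x)%R] <= ((\int[m]_x f x)%R / e)%:E)%E.
Proof.
move=> f_cont fc e0.
have f_meas := continuous_borel_measurable f_cont.
have f_int := continuous_integrable f_cont fc.
have f_emeas : measurable_fun [set: borel T] (EFin \o f).
  exact/measurable_EFinP.
have := @le_integral_comp_abse _ (borel T) R m setT measurableT (EFin \o f) e id
  (@measurable_id _ _ _) (fun _ => id) (fun x y _ _ => id) f_emeas e0.
rewrite setTI.
have f_abs x : `|f x| = f x by rewrite ger0_norm//; case/andP: (fc x).
rewrite (_ : [set x | _] = [set x | e <= f x]); last first.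
  by apply/seteqP; split=> x /=; rewrite f_abs lee_fin.
under eq_integral do rewrite /= f_abs.
rewrite EFinM lee_pdivlMr// muleC /Rintegral fineK//.
exact: integrable_fin_num.
Qed.

End borel_integral.

Section transfer_invariance.
Context (R : realType) (Sigma : pmetricType R).
Variables (a rho : R) (theta : Sigma -> Sigma) (phi : Sigma -> R).
Hypotheses (expanding : ruelle_expanding a rho theta)
  (normalized_phi : normalized theta phi) (phi_cont : continuous phi).
Variable nu : probability (borel Sigma) R.
Hypothesis nuP : transfer_fixed theta phi nu.

(** Iterating the invariance of [nu] under the transfer operator requires that
    each iterate be continuous again; this is where expansion enters. *)
Lemma Rintegral_transfer n (f : Sigma -> R) : continuous f ->
  \int[nu]_x transfer theta phi n f x = \int[nu]_x f x.
Proof.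
move=> f_cont; elim: n => [|n IHn].
  by apply: eq_Rintegral => x _; rewrite transfer0.
rewrite -IHn -[RHS]nuP; last exact: transfer_continuous expanding _ _ _ _ _.
by apply: eq_Rintegral => x _; rewrite -add1n transferD// transfer1E.
Qed.

End transfer_invariance.

Section summable_exceptions.
Context d (T : measurableType d) (R : realType) (P : probability T R).

Lemma ae_choice (U : Type) (Q : T -> U -> Prop) : inhabited U ->
  {ae P, forall s, exists u, Q s u} ->
  exists f : T -> U, {ae P, forall s, Q s (f s)}.
Proof.
case=> u0 aeQ.
have /choice[f fQ] : forall s, exists u, (exists v, Q s v) -> Q s u.
  move=> s; have [[u Qu]|noQ] := pselect (exists u, Q s u); first by exists u.
  by exists u0 => /noQ.
by exists f; apply: filterS aeQ => s /fQ.
Qed.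

(** The Borel-Cantelli lemma with a geometric bound. *)
Lemma ae_eventually_not (F : nat -> set T) C q : 0 < q < 1 ->
  (forall n, measurable (F n)) -> (forall n, (P (F n) <= (C * q ^+ n)%:E)%E) ->
  {ae P, forall s, exists N, forall n, (N < n)%N -> ~ F n s}.
Proof.
move=> /andP[q0 q1] mF PF.
have : P (lim_sup_set F) = 0%E.
  apply: lim_sup_set_cvg0 => //.
  apply: (@le_lt_trans _ _ (C / (1 - q))%:E); last exact: ltry.
  apply: lime_le; first exact: is_cvg_nneseries.
  apply: nearW => n /=.
  apply: (@le_trans _ _ (series (geometric C q) n)%:E).
    by rewrite -sumEFin; apply: lee_sum => k _; exact: PF.
  rewrite lee_fin geometric_seriesE ?lt_eqF//.
  have C0 : 0 <= C.
    by have := PF 0%N; rewrite expr0 mulr1 -lee_fin; exact: le_trans.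
  rewrite ler_wpM2r ?invr_ge0 ?subr_ge0 ?(ltW q1)// ler_piMr//.
  by rewrite gerBl exprn_ge0// ltW.
move=> limF0; exists (lim_sup_set F); split=> //.
  by apply: bigcap_measurable => // k _; apply: bigcup_measurable.
move=> s /= noN n _; apply: contrapT => sF; apply: noN; exists n => k nk Fks.
by apply: sF; exists k => //=; exact: ltnW.
Qed.

End summable_exceptions.

(** * Histories *)

Section history_law.
Context (R : realType) (Sigma : pmetricType R) (theta : Sigma -> Sigma).
Variable surj : forall xi, exists xi', theta xi' = xi.

Lemma hist_continuous n : continuous (fun s : natext surj => hist s n).
Proof.
move=> s; apply: (@continuous_comp _ (prod_topology (fun _ : nat => Sigma)) _
  (fun s : natext surj => set_val s) (fun u => u n)).
  exact: initial_continuous.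
exact: proj_continuous.
Qed.

(** Pushing a history forward shifts its coordinates by one, so by invariance of
    [nud] all coordinates have the same law. *)
Lemma natext_lift_hist nu nud n (A : set (borel Sigma)) :
  natext_lift nu nud -> measurable A ->
  nud ((fun s : natext surj => hist s n) @^-1` A) = nu A.
Proof.
case=> push_inv law0 mA; elim: n => [|n IHn]; first exact: law0.
rewrite -IHn -push_inv//.
apply: (continuous_borel (f := fun s : natext surj => hist s n.+1)) => //.
exact: hist_continuous.
Qed.

End history_law.

Section natural_extension_orbits.
Context (R : realType) (Sigma : pmetricType R) (X : metricType R).
Variables (theta : Sigma -> Sigma) (kappa : Sigma -> homeo X).
Variable surj : forall xi, exists xi', theta xi' = xi.
Implicit Type s : natext surj.

Lemma iter_hist s n m : iter n theta (hist s (n + m)) = hist s m.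
Proof. by elim: n => // n IHn; rewrite iterSr addSn histE. Qed.

(** The n-step cocycle at s_n factors through s_n, ..., s_1, and its inverse
    undoes the factor at s_1 first, which is the order in which the inverse of
    the natural extension meets these points. *)
Lemma iter_skew_natext_inv n s x : iter n (skew_natext_inv kappa) (s, x) =
  (iter n (@natext_pull R Sigma theta surj) s,
   kappa_pull theta kappa n (hist s n) x).
Proof.
elim: n s x => [//|n IHn] s x.
by rewrite !iterSr IHn kappa_pullS -[n.+1]addn1 iter_hist addn1.
Qed.

Lemma natext_distxx s : natext_dist s s = 0.
Proof.
rewrite /natext_dist (_ : series _ = fun=> 0); first exact: lim_cst.
by apply/funext => n; rewrite /series/= big1// => k _; rewrite mdistxx mulr0.
Qed.

End natural_extension_orbits.

(** * Contraction along almost every history *)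

Section synchronization.
Import numFieldNormedType.Exports.
Context (R : realType) (Sigma X : pmetricType R).
Variables (a rho alpha : R) (theta : Sigma -> Sigma) (phi : Sigma -> R)
  (kappa : Sigma -> homeo X).
Hypotheses (compact_Sigma : compact [set: Sigma])
  (compact_X : compact [set: X])
  (expanding : ruelle_expanding a rho theta)
  (alpha0 : 0 < alpha) (hoelder_phi : hoelder_continuous alpha phi)
  (normalized_phi : normalized theta phi)
  (continuous_T : continuous (skew_product theta kappa))
  (lca : locally_contracting_in_average a rho alpha theta phi kappa)
  (cib : always_contracting_inverse_branch a theta kappa).
Variables (nu : probability (borel Sigma) R)
  (nuP : transfer_fixed theta phi nu)
  (nud : probability (borel (natext (normalized_surj normalized_phi))) R)
  (nudP : natext_lift nu nud).
Local Notation pull := (kappa_pull theta kappa).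
Let a0 : 0 < a. Proof. by case: expanding. Qed.

Lemma continuous_fibre_dist n x y :
  continuous (fun eta => capped_dist a alpha (pull n eta x) (pull n eta y)).
Proof.
have theta_cont : continuous theta by case: expanding.
have pull_cont z : continuous (pull n ^~ z).
  move=> eta; apply: (@continuous2_cvg _ _ _ _ _ _ id (fun=> z) (pull n)).
  - exact: (kappa_pull_continuous compact_Sigma compact_X theta_cont
      continuous_T (x := (eta, z))).
  - exact: cvg_id.
  - exact: cvg_cst.
exact: capped_dist_continuous.
Qed.

(** The Markov inequality with threshold t^n, where t lies strictly between the
    decay rate s of the averages and 1; the bound then decays like (s / t)^n. *)
Lemma fibre_dist_tail : exists C q t,
  [/\ 0 < q < 1, 0 < t < 1 & forall x y n,
    (nu [set eta |
       (t ^+ n <= capped_dist a alpha (pull n eta x) (pull n eta y))%R]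
     <= (C * q ^+ n)%:E)%E].
Proof.
have phi_cont := hoelder_is_continuous alpha0 hoelder_phi.
have [c _ phic] : exists2 c, c \in [set: Sigma] &
    forall xi, xi \in [set: Sigma] -> phi c <= phi xi.
  apply: compact_EVT_min => //; first by exists point.
  exact: continuous_subspaceT.
have [C [s [/andP[s0 s1] Cs]]] :=
  mean_dist_exponential a0 alpha0 normalized_phi
    (fun xi => phic xi (mem_set I)) lca cib.
have [t /andP[st t1]] : exists t, s < t < 1.
  by exists ((s + 1) / 2); rewrite !midf_lt.
have t0 : 0 < t := lt_trans s0 st.
exists C, (s / t), t; split; rewrite ?t0//.
  by rewrite divr_gt0//= ltr_pdivrMr// mul1r.
move=> x y n; pose D eta := capped_dist a alpha (pull n eta x) (pull n eta y).
have D_cont : continuous D := @continuous_fibre_dist n x y.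
have D_cap eta : 0 <= D eta <= a `^ alpha.
  by rewrite capped_dist_ge0 capped_dist_le.
apply: le_trans (continuous_markov nu D_cont D_cap (exprn_gt0 n t0)) _.
rewrite lee_fin expr_div_n mulrA ler_pM2r ?invr_gt0 ?exprn_gt0//.
rewrite -(Rintegral_transfer expanding normalized_phi phi_cont nuP n D_cont).
apply: continuous_Rintegral_le => [|xi].
  exact: transfer_continuous expanding _ _ _ _ _.
rewrite Cs andbT; apply: transfer_ge0 => // eta; exact: capped_dist_ge0.
Qed.

(** The events of [fibre_dist_tail] occur finitely often along almost every
    history.  Outside of them, and once the cap is no longer active, the
    distance is below u^n with u = t^(1 / alpha).  Enlarging u to [tau] makes
    room for the factor d(x, y), which u^n alone need not respect. *)
Lemma fibre_dist_ae : exists2 tau : R, 0 < tau < 1 & forall x y : X,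
  {ae nud, forall s, exists N, forall n : nat, (N < n)%N ->
    mdist (pull n (hist s n) x) (pull n (hist s n) y) <= tau ^+ n * mdist x y}.
Proof.
have [C [q [t [q01 /andP[t0 t1] tail]]]] := fibre_dist_tail.
pose u := t `^ alpha^-1.
have u0 : 0 < u by rewrite powR_gt0.
have u1 : u < 1.
  have := @gt0_ltr_powR R alpha^-1 _ t 1; rewrite !nnegrE powR1 invr_gt0.
  by apply=> //; exact: ltW.
have [tau /andP[utau tau1]] : exists tau, u < tau < 1.
  by exists ((u + 1) / 2); rewrite !midf_lt.
have tau0 : 0 < tau := lt_trans u0 utau.
exists tau => [|x y]; first by rewrite tau0.
have [<-|xy] := eqVneq x y.
  by apply: aeW => s; exists 0%N => n _; rewrite !mdistxx mulr0.
pose F n := [set eta |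
  t ^+ n <= capped_dist a alpha (pull n eta x) (pull n eta y)].
have mF n : measurable (F n : set (borel Sigma)).
  by apply: measurable_superlevel; exact: continuous_fibre_dist.
pose surj := normalized_surj normalized_phi.
pose G n := (fun s : natext surj => hist s n) @^-1` F n.
have mG n : measurable (G n : set (borel (natext surj))).
  by apply: continuous_borel (mF n); exact: hist_continuous.
have nudG n : (nud (G n) <= (C * q ^+ n)%:E)%E.
  by rewrite (natext_lift_hist _ nudP (mF n)); exact: tail.
have [M small] : exists M, forall n, (M <= n)%N ->
    t ^+ n < a `^ alpha /\ u ^+ n <= tau ^+ n * mdist x y.
  have t_cvg : t ^+ n @[n --> \oo] --> (0 : R).
    by apply: cvg_expr; rewrite ger0_norm// ltW.
  have ut_cvg : (u / tau) ^+ n @[n --> \oo] --> (0 : R).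
    apply: cvg_expr; rewrite ger0_norm ?divr_ge0 ?ltW//.
    by rewrite ltr_pdivrMr// mul1r.
  have t_small : \forall n \near \oo, t ^+ n < a `^ alpha.
    by apply: cvgr_lt t_cvg _ _; rewrite powR_gt0.
  have ut_small : \forall n \near \oo, (u / tau) ^+ n < mdist x y.
    by apply: cvgr_lt ut_cvg _ _; rewrite mdist_gt0.
  have [M _ MP] := filterI t_small ut_small.
  exists M => n /MP[/= tn].
  rewrite expr_div_n ltr_pdivrMr ?exprn_gt0// mulrC => un.
  by split => //; exact: ltW.
have := ae_eventually_not q01 mG nudG.
apply: filterS => s [N near]; exists (maxn N M) => n; rewrite gtn_max.
case/andP => /near + /ltnW/small[ta utau_n].
(* As t^n < a^alpha, the minimum is below t^n through the distance itself. *)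
rewrite /G/F/= => /negP; rewrite -ltNge gt_min orbC ltNge (ltW ta)/= => small_n.
apply: le_trans utau_n.
have alphaN0 : alpha != 0 by rewrite gt_eqF.
rewrite -[leLHS]powRr1 ?mdist_ge0// -(mulfV alphaN0) powRrM.
have -> : u ^+ n = (t ^+ n) `^ alpha^-1.
  by rewrite -[LHS]powR_mulrn ?powR_ge0// -powRrM mulrC powRrM powR_mulrn// ltW.
by rewrite ge0_ler_powR ?nnegrE ?powR_ge0 ?exprn_ge0 ?invr_ge0 ?ltW.
Qed.

End synchronization.

(** * Synchronization *)

Section synchronizing_orbits.
Import numFieldNormedType.Exports.
Context (R : realType) (Sigma : pmetricType R) (X : metricType R).
Variables (theta : Sigma -> Sigma) (kappa : Sigma -> homeo X).
Variable surj : forall xi, exists xi', theta xi' = xi.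

(** The two orbits share their history, so only the fibre coordinates
    contribute to the distance. *)
Lemma skew_natext_inv_synchronizes (tau : R) (N : nat) (s : natext surj) x y :
  0 < tau < 1 ->
  (forall n, (N < n)%N ->
     mdist (kappa_pull theta kappa n (hist s n) x)
           (kappa_pull theta kappa n (hist s n) y) <= tau ^+ n * mdist x y) ->
  skew_natext_dist (iter n (skew_natext_inv kappa) (s, x))
                   (iter n (skew_natext_inv kappa) (s, y))
    @[n --> \oo] --> (0 : R).
Proof.
move=> /andP[tau0 tau1] near.
under eq_cvg do
  rewrite !iter_skew_natext_inv /skew_natext_dist /= natext_distxx add0r.
have tau_cvg : tau ^+ n * mdist x y @[n --> \oo] --> (0 : R).
  rewrite -[X in _ --> X](mul0r (mdist x y)); apply: cvgMr_tmp.
  by apply: cvg_expr; rewrite ger0_norm// ltW.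
apply: squeeze_cvgr tau_cvg; last exact: cvg_cst.
by exists N.+1 => // n /near le_n; rewrite mdist_ge0.
Qed.

End synchronizing_orbits.

Theorem theorem3p8 (R : realType) (Sigma X : pmetricType R)
    (a rho alpha : R) (theta : Sigma -> Sigma) (phi : Sigma -> R)
    (kappa : Sigma -> homeo X)
    (compact_Sigma : compact [set: Sigma]) (diam_Sigma : diameter Sigma = 1)
    (compact_X : compact [set: X]) (diam_X : diameter X = 1)
    (expanding : ruelle_expanding a rho theta)
    (alpha01 : 0 < alpha <= 1) (hoelder_phi : hoelder_continuous alpha phi)
    (normalized_phi : normalized theta phi)
    (continuous_T : continuous (skew_product theta kappa))
    (bca : backward_contracting_in_average a rho alpha theta phi kappa)
    (cib : always_contracting_inverse_branch a theta kappa)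
    (nu : probability (borel Sigma) R)
    (nuP : transfer_fixed theta phi nu)
    (mu : probability (borel (Sigma * X)%type) R)
    (muP : transfer_fixed (Y := (Sigma * X)%type) (skew_product theta kappa) (phi \o fst) mu)
    (nud : probability (borel (natext (normalized_surj normalized_phi))) R)
    (nudP : natext_lift nu nud) :
  (exists2 tau : R, tau < 1 & forall x y : X,
     exists N : natext (normalized_surj normalized_phi) -> nat,
       {ae nud, forall s, forall n : nat, (N s < n)%N ->
          mdist (kappa_pull theta kappa n (hist s n) x)
                (kappa_pull theta kappa n (hist s n) y)
          <= tau ^+ n * mdist x y}) /\
  (forall x y : X,
     {ae nud, forall s,
        skew_natext_dist (iter n (skew_natext_inv kappa) (s, x))
                         (iter n (skew_natext_inv kappa) (s, y))
          @[n --> \oo] --> (0 : R)}).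
Proof.
have /andP[alpha0 _] := alpha01; have [_ lca] := bca.
have [tau tau01 sync] := fibre_dist_ae compact_Sigma compact_X expanding alpha0
  hoelder_phi continuous_T lca cib nuP nudP.
split=> [|x y].
  exists tau => [|x y]; first by case/andP: tau01.
  exact: ae_choice (inhabits 0%N) (sync x y).
apply: (@filterS _ _ (ae_filter_ringOfSetsType nud)) (sync x y) => s [N near].
exact: skew_natext_inv_synchronizes tau01 near.
Qed.
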